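(* Let $(S,\mathcal{F})$ be an antimatroid on a finite set $S$. Let $d\colon\mathcal{F}\setminus\{\emptyset\}\to S$ be any function with $d(X)\in X$ and $X\setminus\{d(X)\}\in\mathcal{F}$ for all $X\in\mathcal{F}\setminus\{\emptyset\}$. Let $\succ^*$ be any total order on $\mathcal{F}\setminus\{\emptyset\}$ such that $X\succ^* Y$ whenever $X\subsetneq Y$. For each $X=\{a_1,\dots,a_k\}\in\mathcal{F}\setminus\{\emptyset\}$, let $\succ^X$ be the order $a_1\succ^X\cdots\succ^X a_k$ on $X$, where the labelling is defined by $a_i=d(X\setminus\{a_{i+1},\dots,a_k\})$ for $i=k,k-1,\dots,1$. Construct the stable matching instance $(G=(U,V;E),\succ)$ with $U=\mathcal{F}\setminus\{\emptyset\}$, $V=S$, $E=\{(u,v)\mid u\in U,\ v\in u\}$, $\succ_u=\succ^u$ for each $u\in U$, and $\succ_v$ the restriction of $\succ^*$ to $\{u\in U\mid v\in u\}$ for each $v\in V$. For $U'\subseteq U$ let $F(U')\subseteq V$ be the set of vertices of $V$ matched in a stable matching of the restricted instance on $G[U'\cup V]$. Then $\{F(U')\mid U'\subseteq U\}=\mathcal{F}$.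
   Context: A set system $(S,\mathcal{F})$ with $\mathcal{F}\subseteq 2^S$ is an antimatroid if $\mathcal{F}\neq\emptyset$, every nonempty $X\in\mathcal{F}$ has an element $e\in X$ with $X\setminus\{e\}\in\mathcal{F}$ (accessibility), and $X,Y\in\mathcal{F}$ implies $X\cup Y\in\mathcal{F}$ (union-closedness). A stable matching instance is a bipartite graph in which each vertex $r$ has a strict total order $\succ_r$ on its neighbors. A matching $M$ is a set of edges no two sharing a vertex; for $(u,v)\in M$ write $M(u)=v$, $M(v)=u$. An edge $(u,v)$ blocks $M$ if ($u$ is unmatched or $v\succ_u M(u)$) and ($v$ is unmatched or $u\succ_v M(v)$); $M$ is stable if no edge blocks it. In the restricted instance on $G[U'\cup V]$ (induced subgraph), preferences are restricted to neighbors in that subgraph. All stable matchings of an instance match the same vertex set, so $F(U')$ is well defined (e.g., via the output of the $U$-proposing deferred acceptance algorithm). *)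

(* Defs.v *)
From HB Require Import structures.
From mathcomp Require Import all_boot.

Set Implicit Arguments.
Unset Strict Implicit.
Unset Printing Implicit Defensive.

Definition strict_total_on (T : finType) (A : pred T) (r : rel T) : Prop :=
  [/\ forall x, A x -> ~~ r x x,
      forall x y z, A x -> A y -> A z -> r x y -> r y z -> r x z
    & forall x y, A x -> A y -> x != y -> r x y || r y x].

(* The preference [prefU I u v v'] reads "v is preferred to v' by u". The       *)
(* relations are total functions, but only their values on neighbours matter.  *)
Record sm_instance (U V : finType) := SMInstance {
  edge : U -> V -> bool;
  prefU : U -> rel V;
  prefV : V -> rel U;
  prefU_strict : forall u, strict_total_on (edge u) (prefU u);
  prefV_strict : forall v, strict_total_on (fun u => edge u v) (prefV v)
}.

Definition matching (U V : finType) (I : sm_instance U V)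
    (M : {set U * V}) : bool :=
  [forall e in M, edge I e.1 e.2] &&
  [forall e in M, forall f in M, (e != f) ==> (e.1 != f.1) && (e.2 != f.2)].

Definition matchedU (U V : finType) (M : {set U * V}) : {set U} :=
  [set e.1 | e in M].

Definition matchedV (U V : finType) (M : {set U * V}) : {set V} :=
  [set e.2 | e in M].

Definition blocks (U V : finType) (I : sm_instance U V) (M : {set U * V})
    (u : U) (v : V) : bool :=
  [&& edge I u v,
      (u \notin matchedU M) || [exists v', ((u, v') \in M) && prefU I u v v']
    & (v \notin matchedV M) || [exists u', ((u', v) \in M) && prefV I v u u']].

Definition stable (U V : finType) (I : sm_instance U V)
    (M : {set U * V}) : bool :=
  matching I M && [forall u, forall v, ~~ blocks I M u v].

Lemma strict_total_best (T : finType) (A B : pred T) (r : rel T) (x : T) :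
  strict_total_on A r -> (forall y, B y -> A y) -> B x ->
  exists2 y, B y & (y = x \/ r y x) /\ (forall z, B z -> ~~ r z y).
Proof.
move=> [irr tr _] BA; have [n] := ubnP #|[pred z | B z && r z x]|.
elim: n x => // n IH x ltn Bx.
case: (pickP [pred z | B z && r z x]) => [y /= /andP[By ryx] | none]; last first.
  exists x => //; split; [by left | move=> z Bz; have /= := none z].
  by rewrite Bz /= => /negbT.
have [|//|z Bz [zy zbest]] := IH y.
  apply: leq_trans (ltn : _ <= n); apply: proper_card; apply/properP; split.
    apply/subsetP=> z; rewrite !inE => /andP[Bz rzy]; rewrite Bz /=.
    by apply: tr rzy ryx; apply: BA.
  by exists y; rewrite !inE By //= (negPf (irr _ (BA _ By))).
exists z => //; split=> //; right; case: zy => [-> //|rzy].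
by apply: tr rzy ryx; apply: BA.
Qed.

Lemma matchedUP (U V : finType) (M : {set U * V}) u :
  reflect (exists v, (u, v) \in M) (u \in matchedU M).
Proof.
apply: (iffP imsetP) => [[[u' v] Mv /= ->]|[v Mv]]; first by exists v.
by exists (u, v).
Qed.

Lemma matchedVP (U V : finType) (M : {set U * V}) v :
  reflect (exists u, (u, v) \in M) (v \in matchedV M).
Proof.
apply: (iffP imsetP) => [[[u v'] Mv /= ->]|[u Mv]]; first by exists u.
by exists (u, v).
Qed.

Lemma matchingP (U V : finType) (I : sm_instance U V) (M : {set U * V}) :
  reflect [/\ forall u v, (u, v) \in M -> edge I u v,
              forall u v v', (u, v) \in M -> (u, v') \in M -> v = v'
            & forall u u' v, (u, v) \in M -> (u', v) \in M -> u = u']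
          (matching I M).
Proof.
apply: (iffP andP) => [[/forall_inP E /forall_inP D]|[E DU DV]].
  split=> [u v /E //|u v v' Mv Mv'|u u' v Mu Mu'].
    have /forall_inP/(_ _ Mv') := D _ Mv.
    by case: eqP => [[->]//|_] /=; rewrite eqxx.
  have /forall_inP/(_ _ Mu') := D _ Mu.
  by case: eqP => [[->]//|_] /=; rewrite eqxx andbF.
split; first by apply/forall_inP=> [[u v]] /E.
apply/forall_inP=> [[u v]] Mu; apply/forall_inP=> [[u' v']] Mu' /=.
apply/implyP=> ne; apply/andP; split; apply: contraNneq ne => e.
  by subst u'; rewrite (DU _ _ _ Mu Mu').
by subst v'; rewrite (DV _ _ _ Mu Mu').
Qed.

Lemma stable_edge (U V : finType) (I : sm_instance U V) M u v :
  stable I M -> edge I u v ->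
  (exists2 v', (u, v') \in M & ~~ prefU I u v v') \/
  (exists2 u', (u', v) \in M & ~~ prefV I v u u').
Proof.
move=> /andP[_ /forallP/(_ u)/forallP/(_ v)] nb e.
move: nb; rewrite /blocks e /= negb_and !negb_or !(negbK (_ \in _)).
case/orP=> /andP[].
  move=> /matchedUP[v' Mv']; rewrite negb_exists => /forallP/(_ v'); rewrite Mv' /= => np.
  by left; exists v'.
move=> /matchedVP[u' Mu']; rewrite negb_exists => /forallP/(_ u'); rewrite Mu' /= => np.
by right; exists u'.
Qed.

(* Gale-Shapley, with the set of rejected pairs obtained as a least fixpoint.  *)
Lemma stable_exists (U V : finType) (I : sm_instance U V) :
  exists M, stable I M.
Proof.
pose A (R : {set U * V}) := [set e | edge I e.1 e.2 &&
  [forall v, edge I e.1 v && prefU I e.1 v e.2 ==> ((e.1, v) \in R)]].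
pose f R := [set e | edge I e.1 e.2 &&
  [exists u, ((u, e.2) \in A R) && prefV I e.2 u e.1]].
have Amono (R R' : {set U * V}) : R \subset R' -> A R \subset A R'.
  move=> /subsetP sRR'; apply/subsetP=> e; rewrite !inE => /andP[-> /=].
  move=> /forallP h; apply/forallP=> v; apply/implyP=> hv.
  by apply: sRR'; exact: (implyP (h v)).
have fmono : {homo f : R R' / R \subset R'}.
  move=> R R' sRR'; apply/subsetP=> e; rewrite !(inE, in_set) => /andP[-> /=].
  case/existsP=> u /andP[hu pu]; apply/existsP; exists u; rewrite pu andbT.
  by move: hu; apply: (subsetP (Amono _ _ sRR')).
pose R := fixset f; have fR : f R = R by exact: fixsetK.
have inA u v : reflect
    (edge I u v /\ forall v', edge I u v' -> prefU I u v' v -> (u, v') \in R)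
    ((u, v) \in A R).
  rewrite inE /=; apply: (iffP andP) => -[e h]; split=> //.
    by move=> v' e' p; move/forallP/(_ v'): h; rewrite e' p.
  by apply/forallP=> v'; apply/implyP=> /andP[]; exact: h.
have inR u v : reflect
    (edge I u v /\ exists2 u', (u', v) \in A R & prefV I v u' u)
    ((u, v) \in R).
  have -> : ((u, v) \in R) = ((u, v) \in f R) by rewrite fR.
  rewrite in_set /=; apply: (iffP andP) => -[e h]; split=> //.
    by case/existsP: h => u' /andP[]; exists u'.
  by case: h => u' a p; apply/existsP; exists u'; rewrite a p.
exists (A R :\: R); apply/andP; split.
  apply/matchingP; split.
  - by move=> u v /setDP[/inA[]].
  - move=> u v v' /setDP[/inA[e h] nR] /setDP[/inA[e' h'] nR'].
    apply/eqP; apply: contraT => ne.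
    have [_ _ /(_ _ _ e e' ne) /orP[p|p]] := prefU_strict I u.
      by rewrite h' in nR.
    by rewrite h in nR'.
  move=> u u' v /setDP[a nR] /setDP[a' nR'].
  have [/inA[e _] /inA[e' _]] := (a, a').
  apply/eqP; apply: contraT => ne.
  have [_ _ /(_ _ _ e e' ne) /orP[p|p]] := prefV_strict I v.
    by case/negP: nR'; apply/inR; split=> //; exists u.
  by case/negP: nR; apply/inR; split=> //; exists u'.
apply/forallP=> u; apply/forallP=> v; apply/negP=> /and3P[e bu bv].
have [irrU trU totU] := prefU_strict I u.
have [irrV trV totV] := prefV_strict I v.
have bestU w : (u, w) \in A R -> (u, w) \notin R ->
    (w == v) || prefU I u w v -> False.
  move=> a nR pw; have Mw : (u, w) \in A R :\: R by rewrite inE nR.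
  have ew : edge I u w by case/inA: a.
  case/orP: bu => [/negP[]|/existsP[w' /andP[/setDP[a' nR'] pv]]].
    by apply/matchedUP; exists w.
  have [e' h'] := inA _ _ a'.
  case/orP: pw => [/eqP ?|pw]; first by subst w; rewrite h' in nR.
  by rewrite h' in nR => //; exact: trU pw pv.
case: (boolP ((u, v) \in A R)) => a.
  case: (boolP ((u, v) \in R)) => [r|nr]; last by apply: (bestU v); rewrite ?eqxx.
  have [_ [u1 a1 p1]] := inR _ _ r.
  have [|w aw [wu wbest]] :=
      @strict_total_best _ _ (fun w => (w, v) \in A R) _ u1 (prefV_strict I v) _ a1.
    by move=> w /inA[].
  have ew : edge I w v by case/inA: aw.
  have e1 : edge I u1 v by case/inA: a1.
  have pw : prefV I v w u by case: wu => [->//|q]; exact: trV q p1.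
  have Mw : (w, v) \in A R :\: R.
    by rewrite inE aw andbT; apply/negP => /inR[_ [z az pz]]; case/negP: (wbest _ az).
  case/orP: bv => [/negP[]|/existsP[w' /andP[/setDP[a' nR'] pv]]].
    by apply/matchedVP; exists w.
  case/negP: nR'; apply/inR; split; first by case/inA: a'.
  by exists w => //; apply: trV pw pv => //; case/inA: a'.
have [v1 [e1 p1] n1] : exists2 v1, edge I u v1 /\ prefU I u v1 v & (u, v1) \notin R.
  move: a; rewrite inE /= e /= => /forallPn[v1]; rewrite negb_imply => /andP[/andP[]].
  by exists v1.
have [||w /andP[ew nw] [wv wbest]] := @strict_total_best _ _
    (fun w => edge I u w && ((u, w) \notin R)) _ v1 (prefU_strict I u) _ _.
- by move=> w /andP[].
- by rewrite e1.
apply: (bestU w) => //; last first.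
  by case: wv => [->|q]; rewrite ?p1 ?orbT // (trU _ _ _ _ _ _ q p1) ?orbT.
apply/inA; split=> // z ez pz; apply: contraT => nz.
by have := wbest z; rewrite ez nz pz => /(_ isT).
Qed.

Lemma stable_matchedV_sub (U V : finType) (I : sm_instance U V) M N :
  stable I M -> stable I N -> matchedV N \subset matchedV M.
Proof.
move=> sM sN; have [/andP[/matchingP[ME MU MV] _] /andP[/matchingP[NE NU NV] _]] := (sM, sN).
(* A: the u that strictly prefer M to N; B: the v that strictly prefer N to M *)
pose A := [set u | [exists v, ((u, v) \in M) &&
                     [forall v', ((u, v') \in N) ==> prefU I u v v']]].
pose B := [set v | [exists u, ((u, v) \in N) &&
                     [forall u', ((u', v) \in M) ==> prefV I v u u']]].
pose MA := [set e.2 | e in [set e in M | e.1 \in A]].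
pose NB := [set e.1 | e in [set e in N | e.2 \in B]].
have cMA : #|A| <= #|MA|.
  rewrite card_in_imset; last first.
    move=> [u v] [u' v']; rewrite !inE /= => /andP[m _] /andP[m' _] e.
    by subst v'; rewrite (MV _ _ _ m m').
  apply: (@leq_trans #|[set e.1 | e in [set e in M | e.1 \in A]]|); last exact: leq_imset_card.
  apply: subset_leq_card; apply/subsetP=> u uA.
  have := uA; rewrite inE => /existsP[v /andP[m _]].
  by apply/imsetP; exists (u, v) => //; rewrite inE m.
have cNB : #|B| <= #|NB|.
  rewrite card_in_imset; last first.
    move=> [u v] [u' v']; rewrite !inE /= => /andP[m _] /andP[m' _] e.
    by subst u'; rewrite (NU _ _ _ m m').
  apply: (@leq_trans #|[set e.2 | e in [set e in N | e.2 \in B]]|); last exact: leq_imset_card.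
  apply: subset_leq_card; apply/subsetP=> v vB.
  have := vB; rewrite inE => /existsP[u /andP[m _]].
  by apply/imsetP; exists (u, v) => //; rewrite inE m.
have sMA : MA \subset B.
  apply/subsetP=> _ /imsetP[[u v] + ->] /=; rewrite inE /= => /andP[m].
  rewrite inE => /existsP[v1 /andP[m1 /forallP h]].
  have ? := MU _ _ _ m m1; subst v1.
  have e := ME _ _ m.
  case: (stable_edge sN e) => [[v' n]|[u' n np]].
    by move/implyP/(_ n): (h v') => ->.
  rewrite inE; apply/existsP; exists u'; rewrite n /=.
  apply/forallP=> u1; apply/implyP=> m'; rewrite (MV _ _ _ m' m).
  have [_ _ tot] := prefV_strict I v.
  have [E|ne] := eqVneq u' u.
    subst u'; have [irr _ _] := prefU_strict I u.
    by move/implyP/(_ n): (h v); rewrite (negPf (irr _ e)).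
  by have := tot _ _ (NE _ _ n) e ne; rewrite (negPf np) orbF.
have sNB : NB \subset A.
  apply/subsetP=> _ /imsetP[[u v] + ->] /=; rewrite inE /= => /andP[n].
  rewrite inE => /existsP[u1 /andP[n1 /forallP h]].
  have ? := NV _ _ _ n n1; subst u1.
  have e := NE _ _ n.
  case: (stable_edge sM e) => [[v' m np]|[u' m]]; last first.
    by move/implyP/(_ m): (h u') => ->.
  rewrite inE; apply/existsP; exists v'; rewrite m /=.
  apply/forallP=> v1; apply/implyP=> n'; rewrite (NU _ _ _ n' n).
  have [_ _ tot] := prefU_strict I u.
  have [E|ne] := eqVneq v' v.
    subst v'; have [irr _ _] := prefV_strict I v.
    by move/implyP/(_ m): (h u); rewrite (negPf (irr _ e)).
  by have := tot _ _ (ME _ _ m) e ne; rewrite (negPf np) orbF.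
have eMA : MA = B.
  apply/eqP; rewrite eqEcard sMA (leq_trans cNB) //.
  exact: leq_trans (subset_leq_card sNB) cMA.
apply/subsetP=> v /matchedVP[u n]; apply/matchedVP.
case: (boolP [exists u', (u', v) \in M]) => [/existsP//|/existsPn nM].
have : v \in MA.
  rewrite eMA inE; apply/existsP; exists u; rewrite n /=.
  by apply/forallP=> u'; rewrite (negPf (nM u')).
by case/imsetP=> [[u' v']] /=; rewrite inE => /andP[m _] ->; exists u'.
Qed.

Lemma stable_matchedV_unique (U V : finType) (I : sm_instance U V) M N :
  stable I M -> stable I N -> matchedV M = matchedV N.
Proof.
by move=> sM sN; apply/eqP; rewrite eqEsubset !(@stable_matchedV_sub _ _ I).
Qed.

(* A stable matching of the instance; by [stable_matchedV_unique] the vertices *)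
(* it matches do not depend on the choice.                                     *)
Definition stable_matching (U V : finType) (I : sm_instance U V) : {set U * V} :=
  xchoose (stable_exists I).

Lemma restrictU_strict (U V : finType) (I : sm_instance U V) (U' : {set U})
    (u : {u : U | u \in U'}) :
  strict_total_on (edge I (val u)) (prefU I (val u)).
Proof. exact: prefU_strict. Qed.

Lemma restrictV_strict (U V : finType) (I : sm_instance U V) (U' : {set U})
    (v : V) :
  strict_total_on (fun u : {u : U | u \in U'} => edge I (val u) v)
    (relpre val (prefV I v)).
Proof.
have [irr tr tot] := prefV_strict I v; split=> [x|x y z|x y] /=.
- exact: irr.
- exact: tr.
by move=> ex ey ne; apply: tot => //; rewrite (inj_eq val_inj).
Qed.

(* The induced instance on G[U' \cup V].                                       *)
Definition restrict (U V : finType) (I : sm_instance U V) (U' : {set U}) :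
    sm_instance {u : U | u \in U'} V :=
  SMInstance (@restrictU_strict U V I U') (@restrictV_strict U V I U').

Definition matched_set (U V : finType) (I : sm_instance U V) (U' : {set U}) :
    {set V} :=
  matchedV (stable_matching (restrict I U')).

Lemma matched_setE (U V : finType) (I : sm_instance U V) (U' : {set U}) M :
  stable (restrict I U') M -> matched_set I U' = matchedV M.
Proof.
by move=> sM; apply: stable_matchedV_unique sM; exact: xchooseP.
Qed.

Definition antimatroid (S : finType) (F : {set {set S}}) : Prop :=
  [/\ F != set0,
      forall X, X \in F -> X != set0 -> exists2 e, e \in X & X :\ e \in F
    & forall X Y, X \in F -> Y \in F -> X :|: Y \in F].

Definition nonempty_feasible (S : finType) (F : {set {set S}}) : finType :=
  {X : {set S} | X \in F :\ set0}.

Definition removal (S : finType) (F : {set {set S}})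
    (d : nonempty_feasible F -> S) : Prop :=
  forall X, d X \in val X /\ val X :\ d X \in F.

(* [:: a_1; ...; a_k], produced from the last element down:                    *)
(* a_k = d X, then a_(k-1) = d (X :\ a_k), and so on; [n] is fuel.             *)
Fixpoint labelling_rec (S : finType) (F : {set {set S}})
    (d : nonempty_feasible F -> S) (n : nat) (X : {set S}) : seq S :=
  if n is n'.+1 then
    if insub X is Some X' then
      rcons (labelling_rec d n' (X :\ d X')) (d X')
    else [::]
  else [::].

Definition labelling (S : finType) (F : {set {set S}})
    (d : nonempty_feasible F -> S) (X : nonempty_feasible F) : seq S :=
  labelling_rec d #|val X| (val X).

Definition label_pref (S : finType) (F : {set {set S}})
    (d : nonempty_feasible F -> S) (X : nonempty_feasible F) : rel S :=
  fun a b => index a (labelling d X) < index b (labelling d X).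

Lemma labelling_recP (S : finType) (F : {set {set S}})
    (d : nonempty_feasible F -> S) (X : {set S}) :
  removal d -> X \in F ->
  uniq (labelling_rec d #|X| X) /\ labelling_rec d #|X| X =i X.
Proof.
move=> hd; move En: #|X| => n; elim: n X En => [|n IH] X cX XF /=.
  by move/eqP: cX; rewrite cards_eq0 => /eqP->; split=> // x; rewrite inE.
have XF0 : X \in F :\ set0 by rewrite !inE XF andbT -cards_eq0 cX.
rewrite insubT /=; set X' : nonempty_feasible F := Sub X XF0.
have [dX dF] := hd X'; rewrite SubK in dX dF.
have [|//|us ms] := IH (X :\ d X').
  by apply/eqP; rewrite -eqSS -cX (cardsD1 (d X') X) dX.
split; first by rewrite rcons_uniq us andbT ms !inE eqxx.
by move=> x; rewrite mem_rcons inE ms !inE; case: eqP => [->|].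
Qed.

Lemma labellingP (S : finType) (F : {set {set S}})
    (d : nonempty_feasible F -> S) (X : nonempty_feasible F) :
  removal d -> uniq (labelling d X) /\ labelling d X =i val X.
Proof.
by move=> hd; apply: labelling_recP => //; case/setD1P: (valP X).
Qed.

(* The defining recursion a_i = d (X \ {a_(i+1), ..., a_k}).                   *)
Lemma labelling_nth (S : finType) (F : {set {set S}})
    (d : nonempty_feasible F -> S) (X : nonempty_feasible F) (x0 : S) i :
  removal d -> i < size (labelling d X) ->
  exists2 Y : nonempty_feasible F,
    val Y = val X :\: [set x in drop i.+1 (labelling d X)]
    & nth x0 (labelling d X) i = d Y.
Proof.
move=> hd; rewrite /labelling.
have: val X \in F by case/setD1P: (valP X).
move: (val X) => Z; move En: #|Z| => n; elim: n Z En i => [|n IH] Z cZ i ZF //=.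
have ZF0 : Z \in F :\ set0 by rewrite !inE ZF andbT -cards_eq0 cZ.
rewrite insubT /=; set Z' : nonempty_feasible F := Sub Z ZF0.
have [dZ dF] := hd Z'; rewrite SubK in dZ dF.
have cZ' : #|Z :\ d Z'| = n by apply/eqP; rewrite -eqSS -cZ (cardsD1 (d Z') Z) dZ.
rewrite size_rcons ltnS leq_eqVlt => /orP[/eqP->|lti].
  exists Z'; last by rewrite nth_rcons ltnn eqxx.
  rewrite drop_oversize ?size_rcons // SubK.
  by apply/setP=> x; rewrite !inE.
have [Y eY nY] := IH _ cZ' i dF lti.
exists Y; last by rewrite nth_rcons lti.
rewrite eY drop_rcons //; apply/setP=> x.
by rewrite !inE mem_rcons inE negb_or; case: eqP; rewrite ?andbF //= andbT.
Qed.

Lemma label_pref_strict (S : finType) (F : {set {set S}})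
    (d : nonempty_feasible F -> S) (hd : removal d) (X : nonempty_feasible F) :
  strict_total_on (fun v => v \in val X) (label_pref d X).
Proof.
have [_ m] := labellingP X hd; split=> [x _|x y z _ _ _|x y xX yX ne].
- by rewrite /label_pref ltnn.
- exact: ltn_trans.
rewrite /label_pref -neq_ltn; apply: contra ne => /eqP e.
by rewrite -(nth_index x (_ : x \in labelling d X)) ?m // e nth_index ?m.
Qed.

Lemma strict_total_onW (T : finType) (A : pred T) (r : rel T) :
  strict_total_on predT r -> strict_total_on A r.
Proof.
by case=> irr tr tot; split=> [x _|x y z _ _ _|x y _ _];
  [exact: irr | exact: tr | exact: tot].
Qed.

Definition antimatroid_instance (S : finType) (F : {set {set S}})
    (d : nonempty_feasible F -> S) (hd : removal d)
    (star : rel (nonempty_feasible F)) (hstar : strict_total_on predT star) :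
    sm_instance (nonempty_feasible F) S :=
  @SMInstance (nonempty_feasible F) S
    (fun (u : nonempty_feasible F) v => v \in val u)
    (label_pref d)
    (fun _ => star)
    (label_pref_strict hd)
    (fun v => @strict_total_onW (nonempty_feasible F) (fun u => v \in val u) star hstar).

(* Main.v *)
(* Feasibility of [F(U')]: if a stable matching pairs [u] with [v], then every *)
(* vertex that [u] prefers to [v] is matched as well, so the matched set is    *)
(* the union of the prefixes of the orders [>^u] ending at the partner of [u]; *)
(* these prefixes are feasible. Conversely, a feasible [X = {a_1, ..., a_k}] is *)
(* realised by the chain of prefixes [X_i = {a_1, ..., a_i}]: pairing [X_i]    *)
(* with [a_i] is stable because [a_j] prefers [X_j] to [X_i] for [j < i].      *)
Require Import Defs.
From mathcomp Require Import all_boot.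

(** Every initial segment of an order on [X] is feasible, since it is what remains after removing
    last elements by [d] ([labelling_prefix]). Stability forces whatever [u] prefers to its partner
    to be matched too, so a matched set is a union of such segments, and union-closedness makes it
    feasible ([matched_set_feasible]). Conversely, peeling a feasible [X] down to the empty set
    gives a chain on which [d] is a bijection onto [X] ([removal_chain]). Since smaller sets are
    preferred, pairing each chain member with its image under [d] is stable and matches exactly [X]
    ([feasible_matched_set]). *)

Lemma antimatroid_set0 (S : finType) (F : {set {set S}}) :
  antimatroid F -> set0 \in F.
Proof.
case=> /set0Pn[X XF] acc _; have [n] := ubnP #|X|.
elim: n X XF => // n IH X XF cX; have [<- //|X0] := eqVneq X set0.
have [e eX XeF] := acc X XF X0; apply: IH XeF _.
by move: cX; rewrite (cardsD1 e X) eX.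
Qed.

Lemma antimatroid_bigcup {S : finType} {F : {set {set S}}} (I : finType)
    (P : pred I) (B : I -> {set S}) :
  antimatroid F -> (forall i, P i -> B i \in F) -> \bigcup_(i | P i) B i \in F.
Proof.
move=> hF BF; apply: (big_ind (fun X => X \in F)) => //.
- exact: antimatroid_set0.
- by case: hF.
Qed.

(** [P] is the set left when the labelling recursion is about to remove [v]; it is feasible because
    [d] is only applied to feasible sets. *)
Lemma labelling_prefix {S : finType} {F : {set {set S}}}
    {d : nonempty_feasible F -> S} {X : nonempty_feasible F} {v : S} :
  removal d -> v \in val X ->
  exists2 P, P \in F & [/\ v \in P, P \subset val X
    & forall a, a \in P -> a != v -> label_pref d X a v].
Proof.
move=> hd vX; have [uL mL] := labellingP X hd.
have vL : v \in labelling d X by rewrite mL.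
have [|Y eY] := @labelling_nth S F d X v (index v (labelling d X)) hd.
  by rewrite index_mem.
rewrite nth_index // => vY; have [dY _] := hd Y.
exists (val Y); first by case/setD1P: (valP Y).
split; [by rewrite vY | by rewrite eY subsetDl | move=> a].
rewrite eY !inE => /andP[nd aX] nav; have aL : a \in labelling d X by rewrite mL.
(* The segment includes [v] itself, so this bounds the index of [a] only weakly; equality would
   force [a = v]. *)
have : a \in take (index v (labelling d X)).+1 (labelling d X).
  by move: aL; rewrite -{1}(cat_take_drop (index v (labelling d X)).+1
    (labelling d X)) mem_cat (negPf nd) orbF.
rewrite in_take // ltnS leq_eqVlt => /orP[/eqP e|//].
by rewrite -(nth_index v aL) e nth_index // eqxx in nav.
Qed.

Lemma matched_set_feasible (S : finType) (F : {set {set S}})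
    (hF : antimatroid F) (d : nonempty_feasible F -> S) (hd : removal d)
    (star : rel (nonempty_feasible F)) (hstar : strict_total_on predT star)
    (U' : {set nonempty_feasible F}) :
  matched_set (antimatroid_instance hd hstar) U' \in F.
Proof.
set I := antimatroid_instance hd hstar.
have [M sM] := stable_exists (restrict I U'); rewrite (matched_setE sM).
have /andP[/matchingP[ME MU _] _] := sM.
have prefix v : v \in matchedV M ->
    exists P, [&& P \in F, v \in P & P \subset matchedV M].
  case/matchedVP=> u Muv; have [P PF [vP /subsetP PX Pv]] := labelling_prefix hd (ME _ _ Muv).
  exists P; rewrite PF vP; apply/subsetP=> a aP; apply/matchedVP.
  have [->|nav] := eqVneq a v; first by exists u.
  (* The first alternative fails: the partner of [u] is [v], and [u] prefers [a] to [v]. *)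
  case: (stable_edge sM (PX a aP : edge (restrict I U') u a)) => [[v' Mv']|[u' Mu' _]].
    by rewrite (MU _ _ _ Mv' Muv) /= (Pv a aP nav).
  by exists u'.
(* Taking all feasible subsets of the matched set avoids choosing a segment for each [v]. *)
have -> : matchedV M = \bigcup_(P | (P \in F) && (P \subset matchedV M)) P.
  apply/eqP; rewrite eqEsubset; apply/andP; split.
    apply/subsetP=> v /prefix[P /and3P[PF vP PM]].
    by apply/bigcupP; exists P; rewrite ?PF.
  by apply/bigcupsP=> P /andP[].
by apply: antimatroid_bigcup => // P /andP[].
Qed.

(** [U'] is the chain [X], [X :\ d X], and so on. An element of [Y] other than [d Y] is removed at a
    later stage, hence from a smaller member [Z]. *)
Lemma removal_chain {S : finType} {F : {set {set S}}}
    (d : nonempty_feasible F -> S) (X : {set S}) :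
  removal d -> X \in F ->
  exists U' : {set nonempty_feasible F},
    [/\ d @: U' = X, {in U' &, injective d},
        forall Y, Y \in U' -> val Y \subset X
      & forall Y, Y \in U' -> forall a, a \in val Y -> a != d Y ->
          exists2 Z, Z \in U' & d Z = a /\ val Z \proper val Y].
Proof.
move=> hd; have [n] := ubnP #|X|; elim: n X => // n IH X cX XF.
have [->|X0] := eqVneq X set0.
  by exists set0; rewrite imset0; split=> // Y; rewrite inE.
have XF0 : X \in F :\ set0 by rewrite !inE X0.
pose X' : nonempty_feasible F := Sub X XF0.
have [dX dF] := hd X'; rewrite SubK in dX dF.
have [|//|U' [im inj sub chain]] := IH (X :\ d X').
  by move: cX; rewrite (cardsD1 (d X') X) dX.
have dNX Y : Y \in U' -> d Y != d X'.
  by move=> YU; have := imset_f d YU; rewrite im => /setD1P[].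
exists (X' |: U'); split.
- by rewrite imsetU1 im setD1K.
- move=> Y Z /setU1P[->|YU] /setU1P[->|ZU] //; last exact: inj.
    by move/esym/eqP; rewrite (negPf (dNX _ ZU)).
  by move/eqP; rewrite (negPf (dNX _ YU)).
- move=> Y /setU1P[->|YU]; first by rewrite SubK.
  exact: subset_trans (sub Y YU) (subsetDl _ _).
move=> Y /setU1P[->|YU] a aY naY; last first.
  by have [Z ZU h] := chain Y YU a aY naY; exists Z => //; rewrite inE ZU orbT.
have : a \in d @: U' by rewrite im !inE naY.
case/imsetP=> Z ZU ->; exists Z; first by rewrite inE ZU orbT.
by split=> //; rewrite SubK; apply: sub_proper_trans (sub Z ZU) (properD1 dX).
Qed.

Lemma feasible_matched_set (S : finType) (F : {set {set S}})
    (d : nonempty_feasible F -> S) (hd : removal d)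
    (star : rel (nonempty_feasible F)) (hstar : strict_total_on predT star)
    (hsub : forall X Y : nonempty_feasible F, val X \proper val Y -> star X Y)
    (X : {set S}) :
  X \in F -> exists U', X = matched_set (antimatroid_instance hd hstar) U'.
Proof.
move=> XF; have [U' [im inj _ chain]] := removal_chain d X hd XF.
have [irr tr _] := hstar; exists U'.
pose M : {set {u | u \in U'} * S} := [set e | e.2 == d (val e.1)].
have MP u v : ((u, v) \in M) = (v == d (val u)) by rewrite inE.
have sM : stable (restrict (antimatroid_instance hd hstar) U') M.
  apply/andP; split.
    apply/matchingP; split=> [u v|u v v'|u u' v]; rewrite !MP => /eqP->.
    - by case: (hd (val u)).
    - by move/eqP.
    by move/eqP=> e; apply/val_inj/inj => //; apply: valP.
  apply/forallP=> u; apply/forallP=> v; apply/negP=> /and3P[/= vu _].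
  (* The partner [Z] of [v] is [val u] or a smaller chain member, which [v] prefers; so [v] cannot
     gain by moving to [u]. *)
  have [Z ZU [dZ Zu]] : exists2 Z, Z \in U' & d Z = v /\ (Z = val u \/ star Z (val u)).
    have [->|nv] := eqVneq v (d (val u)).
      by exists (val u); [apply: valP | split; [|left]].
    have [Z ZU [dZ pZ]] := chain _ (valP u) v vu nv.
    by exists Z => //; split=> //; right; apply: hsub.
  case/orP=> [/negP[]|/existsP[u' /andP[]]].
    by apply/matchedVP; exists (Sub Z ZU); rewrite MP SubK dZ.
  rewrite MP -dZ => /eqP e /= uu'.
  have eZ : Z = val u' by apply: inj => //; apply: valP.
  rewrite -{}eZ in uu'; case: Zu => [eZ|Zu]; first by have := irr Z isT; rewrite {1}eZ uu'.
  by have := irr Z isT; rewrite (tr _ _ _ _ _ _ Zu uu').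
rewrite (matched_setE sM) -im; apply/setP=> v; apply/imsetP/matchedVP.
  by case=> Y YU ->; exists (Sub Y YU); rewrite MP SubK.
by case=> u; rewrite MP => /eqP->; exists (val u) => //; apply: valP.
Qed.

Theorem theorem3 (S : finType) (F : {set {set S}}) (hF : antimatroid F)
    (d : nonempty_feasible F -> S) (hd : removal d)
    (star : rel (nonempty_feasible F))
    (hstar : strict_total_on predT star)
    (hsub : forall X Y : nonempty_feasible F,
        val X \proper val Y -> star X Y) :
  [set matched_set (antimatroid_instance hd hstar) U'
    | U' : {set nonempty_feasible F}] = F.
Proof.
apply/setP=> X; apply/imsetP/idP => [[U' _ ->]|XF].
  exact: matched_set_feasible.
by have [U' ->] := feasible_matched_set S F d hd star hstar hsub X XF; exists U'.
Qed.
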